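(* Let $E$ be a Banach space with $(B_{E^{\ast}}, \omega^{\ast})$ convex block compact. If there are $\alpha \in \mathbb{R}$ and a convex weakly compact set $D \subset E$ such that \[ \emptyset \neq P := \Big\{ x^{\ast} \in S_{E^{\ast}} : \sup_{d\in D} x^{\ast}(d) < \alpha \Big\} \subset NA(E), \] then $E$ is reflexive.
   Context: Banach spaces are real. $B_{E}$ and $B_{E^\ast}$ are the closed unit balls of $E$ and $E^\ast$, $S_{E^\ast}$ is the unit sphere of $E^\ast$, and $\omega^\ast=\sigma(E^\ast,E)$. $NA(E)$ is the set of norm-attaining functionals, i.e. those $x^\ast\in E^\ast$ for which there is $x\in B_E$ with $x^\ast(x)=\|x^\ast\|$. Given a sequence $(x_n)_{n\in\mathbb{N}}$ in a vector space, a sequence $(y_n)_{n\in\mathbb{N}}$ is a convex block subsequence of $(x_n)$ if there exist a sequence $(A_n)_{n\in\mathbb{N}}$ of pairwise disjoint finite subsets of $\mathbb{N}$ and a sequence $(\lambda_k)_{k\in\mathbb{N}}$ of real numbers $\lambda_k \ge 0$ such that $y_n = \sum_{k\in A_n}\lambda_k x_k$ and $\sum_{k\in A_n}\lambda_k = 1$ for each $n$. A subset $C$ of a topological vector space $(X,\tau)$ is convex block compact if every sequence of elements of $C$ admits a convex block subsequence which $\tau$-converges to an element of $C$. *)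

(* Defs.v *)
From HB Require Import structures.
From mathcomp Require Import all_boot all_order all_algebra finmap.
From mathcomp Require Import all_classical all_reals all_analysis.

Set Implicit Arguments.
Unset Strict Implicit.
Unset Printing Implicit Defensive.

Import Order.TTheory GRing.Theory Num.Theory.
Import numFieldNormedType.Exports.

Local Open Scope classical_set_scope.
Local Open Scope ring_scope.

Section dual.
Variables (R : realType) (V : normedModType R).

Definition continuous_linear : {pred V -> R^o} :=
  [pred f : V -> R^o | `[< linear f /\ continuous f >]].

Lemma continuous_linearP (f : V -> R^o) :
  reflect (linear f /\ continuous f) (f \in continuous_linear).
Proof. exact: asboolP. Qed.

Record dual := Dual {
  dual_fun :> V -> R^o ;
  dual_subproof : dual_fun \in continuous_linear }.

HB.instance Definition _ := [isSub for dual_fun].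
HB.instance Definition _ := gen_eqMixin dual.
HB.instance Definition _ := gen_choiceMixin dual.

Lemma continuous_linear_submod : submod_closed continuous_linear.
Proof.
split=> [|a f g].
  apply/continuous_linearP; split=> [b x y|x]; last exact: cvg_cst.
  by rewrite scaler0 addr0.
move=> /continuous_linearP[lf cf] /continuous_linearP[lg cg].
apply/continuous_linearP; split=> [b x y|x].
  rewrite /= !fctE lf lg !scalerDr addrACA; congr (_ + _).
  by congr (_ + _); rewrite !scalerA mulrC.
by apply: cvgD; [apply: cvgZr; exact: cf | exact: cg].
Qed.

HB.instance Definition _ :=
  GRing.isSubmodClosed.Build R (V -> R^o) continuous_linear
    continuous_linear_submod.
HB.instance Definition _ := [SubChoice_isSubLmodule of dual by <:].

Lemma dual_linear (f : dual) : linear f.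
Proof. by have /continuous_linearP[] := dual_subproof f. Qed.

HB.instance Definition _ (f : dual) :=
  GRing.isLinear.Build R V R^o *:%R f (dual_linear f).

Lemma dual_continuous (f : dual) : continuous f.
Proof. by have /continuous_linearP[] := dual_subproof f. Qed.

Lemma dual_ext (f g : dual) : f =1 g -> f = g.
Proof. by move=> fg; apply: val_inj; apply/funext. Qed.

Definition dual_norm (f : dual) : R := sup [set `|f x| | x in [set x : V | `|x| <= 1]].

Lemma dual_norm_has_sup (f : dual) :
  has_sup [set `|f x| | x in [set x : V | `|x| <= 1]].
Proof.
split; first by exists `|f 0|, 0 => //=; rewrite normr0.
have /linear_boundedP/pinfty_ex_gt0[M M0 fM] :=
  @continuous_linear_bounded _ _ _ 0 f (@dual_continuous f 0).
exists M => _ [x /= x1 <-]; apply: (le_trans (fM x)).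
by rewrite ler_piMr// ltW.
Qed.

Lemma dual_norm_ub (f : dual) x : `|x| <= 1 -> `|f x| <= dual_norm f.
Proof.
move=> x1; apply: sup_ubound; last by exists x.
by case: (dual_norm_has_sup f).
Qed.

Lemma dual_norm_le (f : dual) M :
  (forall x, `|x| <= 1 -> `|f x| <= M) -> dual_norm f <= M.
Proof.
move=> fM; apply: ge_sup; first by case: (dual_norm_has_sup f).
by move=> _ [x x1 <-]; exact: fM.
Qed.

Lemma dual_norm_ge0 (f : dual) : 0 <= dual_norm f.
Proof. by apply: le_trans (dual_norm_ub f (x := 0) _); rewrite ?normr0. Qed.

Lemma dual_norm_bound (f : dual) x : `|f x| <= dual_norm f * `|x|.
Proof.
have [->|x0] := eqVneq x 0; first by rewrite linear0 !normr0 mulr0.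
have nx0 : 0 < `|x| by rewrite normr_gt0.
rewrite -ler_pdivrMr// mulrC.
have -> : `|x|^-1 * `|f x| = `|f (`|x|^-1 *: x)|.
  by rewrite linearZ normrZ ger0_norm// invr_ge0 ltW.
by apply: dual_norm_ub; rewrite normrZ ger0_norm ?invr_ge0// mulVf// gt_eqF.
Qed.

Lemma dual_normD f g : dual_norm (f + g) <= dual_norm f + dual_norm g.
Proof.
apply: dual_norm_le => x x1; apply: le_trans (ler_normD (f x) (g x)) _.
by rewrite lerD ?dual_norm_ub.
Qed.

Lemma dual_normZ (a : R) f : dual_norm (a *: f) = `|a| * dual_norm f.
Proof.
have le b g : dual_norm (b *: g) <= `|b| * dual_norm g.
  apply: dual_norm_le => x x1; rewrite (_ : (b *: g) x = b *: g x)// normrZ.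
  by rewrite ler_wpM2l// dual_norm_ub.
apply/eqP; rewrite eq_le le/=; have [->|a0] := eqVneq a 0.
  by rewrite normr0 mul0r dual_norm_ge0.
rewrite -ler_pdivlMl ?normr_gt0// -normfV.
by apply: le_trans (le _ _); rewrite scalerA mulVf// scale1r.
Qed.

Lemma dual_norm0_eq0 f : dual_norm f = 0 -> f = 0.
Proof.
move=> f0; apply: dual_ext => x; apply/eqP; rewrite -normr_le0.
by apply: le_trans (dual_norm_bound f x) _; rewrite f0 mul0r.
Qed.

HB.instance Definition _ :=
  Lmodule_isNormed.Build R dual dual_normD dual_normZ dual_norm0_eq0.

End dual.

(* weak_star V is sigma(V', V) and weak V is sigma(V, V'), for V' := dual V:
   initial topologies for the maps into the products of copies of R indexed by
   V and by V'. They live on aliases, so as not to collide with the norm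
   topologies. *)
Definition weak_star (R : realType) (V : normedModType R) :=
  initial_topology (fun f : dual V => (f : V -> R^o) : {ptws V -> R^o}).

HB.instance Definition _ (R : realType) (V : normedModType R) :=
  Topological.copy (weak_star V)
    (initial_topology (fun f : dual V => (f : V -> R^o) : {ptws V -> R^o})).
HB.instance Definition _ (R : realType) (V : normedModType R) :=
  GRing.Lmodule.copy (weak_star V) (dual V).

Definition weak (R : realType) (V : normedModType R) :=
  initial_topology
    (fun x : V => (fun f : dual V => f x) : {ptws dual V -> R^o}).

HB.instance Definition _ (R : realType) (V : normedModType R) :=
  Topological.copy (weak V)
    (initial_topology
      (fun x : V => (fun f : dual V => f x) : {ptws dual V -> R^o})).

Definition weakly_compact (R : realType) (V : normedModType R) (D : set V) :=
  compact (D : set (weak V)).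

Section reflexive_space.
Variables (R : realType) (V : normedModType R).

Lemma bidual_eval_subproof (x : V) :
  (fun f : dual V => f x) \in @continuous_linear R (dual V).
Proof.
have lx : linear (fun f : dual V => f x : R^o) by [].
apply/continuous_linearP; split=> //; pose ev : {linear dual V -> R^o} :=
  HB.pack (fun f : dual V => f x : R^o)
    (GRing.isLinear.Build R (dual V) R^o *:%R _ lx).
apply: (@bounded_linear_continuous _ _ _ ev); apply/linear_boundedP.
near=> r => f; rewrite mulrC.
apply: le_trans (dual_norm_bound f x) _; apply: ler_wpM2l; first exact: dual_norm_ge0.
by near: r; apply: nbhs_pinfty_ge; rewrite num_real.
Unshelve. all: by end_near. Qed.

Definition bidual_eval (x : V) : dual (dual V) := Dual (bidual_eval_subproof x).

Definition reflexive_space := range bidual_eval = setT.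

End reflexive_space.

Definition norm_attaining (R : realType) (V : normedModType R) : set (dual V) :=
  [set f : dual V | exists x : V, `|x| <= 1 /\ f x = `|f|].

Definition convex_block_subseq (R : realType) (X : lmodType R)
    (x y : nat -> X) :=
  exists (A : nat -> {fset nat}) (lambda : nat -> R),
    [/\ forall i j, i != j -> [disjoint A i & A j]%fset,
        forall k, 0 <= lambda k &
        forall n, y n = \sum_(k <- A n) lambda k *: x k /\
                  \sum_(k <- A n) lambda k = 1].

Definition convex_block_compact (R : realType) (X : preTopologicalLmodType R)
    (C : set X) :=
  forall x : nat -> X, (forall n, C (x n)) ->
    exists y : nat -> X, convex_block_subseq x y /\
      exists2 l, C l & y @ \oo --> l.

(* Main.v *)
Require Import Defs.
From HB Require Import structures.
From mathcomp Require Import all_boot all_order all_algebra finmap.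
From mathcomp Require Import ring lra.
From mathcomp Require Import all_classical all_reals all_analysis.
Set Implicit Arguments.
Unset Strict Implicit.
Unset Printing Implicit Defensive.
Import Order.TTheory GRing.Theory Num.Theory.
Import numFieldNormedType.Exports.
Local Open Scope classical_set_scope.
Local Open Scope ring_scope.

(** Suppose that [E] is not reflexive; the goal is a functional [g] whose
    normalization lies in [P] and which does not attain its norm.

    James' classical construction ([james_sequence], from Helly's and Goldstine's
    theorems) gives [f n] in the dual ball and [x m] in the ball of [E] with
    [f n (x m)] bounded below by some [b > 0] for [n <= m], and almost zero for
    [m < n]. Convex block compactness turns [f] into blocks that converge
    weakly-star to some [l]; this [l] vanishes on all [x m], so the differences
    [h] between the blocks and [l] converge to zero pointwise while every convex
    combination of them is at least [b] at the late [x m], hence has norm at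
    least [b] ([weak_star_null_sequence]). From then on only the decreasing
    convex sets [C n] spanned by the tails of [h] matter.

    The engine is Simons' inequality ([simons]): if a sublinear [p] is at least
    [c] on [C 0], then some limit [z] of points of [C 0] is such that every
    linear [l <= p] with [l z = p z] takes values at least [c - e] on every [C n].
    It is used twice.

    With [p] the support function of [D], which is attained because [D] is weakly
    compact, it shows that each [C n] contains functionals that are uniformly
    small from above on [D] ([small_on_weakly_compact]); restricting to these,
    moving from [f0] in [P] by a multiple of an element of [C n] spoils the
    inequality defining [P] arbitrarily little.

    With [p] the dual norm, applied to the sets [f0 + t *: C n], it yields limits
    [g] that do not attain their norm, as soon as the norms of [f0 + t *: u] for
    [u] in [C n] stay away from 1: a point of the unit ball at which the norm is
    attained would be one where the [f0 + t *: u] stay above 1, whereas they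
    converge there to a value of [f0], which is at most 1. So [t] must not be too
    small, and since the norm of [g] must stay close to 1 when [alpha < 0], not too
    large either: it is chosen as the first value for which the norms exceed 1 by
    a prescribed small amount ([nonattaining_perturbation]). *)

(** * Sublinear functionals and the Hahn-Banach theorem *)

Section sublinear_functionals.
Variables (R : realType) (V : lmodType R).
Implicit Types (p q : V -> R) (x y z : V) (t : R).

Definition sublinear p :=
  (forall x y, p (x + y) <= p x + p y) /\
  (forall t x, 0 <= t -> p (t *: x) = t * p x).

Lemma sublinear0 p : sublinear p -> p 0 = 0.
Proof. by move=> [_ pZ]; have := pZ 0 0 (lexx _); rewrite scale0r mul0r. Qed.

Lemma sublinear_ge p x : sublinear p -> - p (- x) <= p x.
Proof.
move=> sp; have := sp.1 x (- x); rewrite subrr sublinear0// => ?.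
by rewrite lerNl -subr_ge0 opprK addrC.
Qed.

Lemma le_sublinear p :
  p 0 = 0 -> (forall x y, p (x + y) <= p x + p y) ->
  (forall t x, 0 < t -> p (t *: x) <= t * p x) -> sublinear p.
Proof.
move=> p0 pD pZ; split=> // t x; rewrite le0r => /predU1P[->|t0].
  by rewrite scale0r mul0r.
apply/eqP; rewrite eq_le pZ//= -ler_pdivlMl//.
have tV : 0 < t^-1 by rewrite invr_gt0.
by apply: le_trans (pZ _ (t *: x) tV); rewrite scalerA mulVf ?scale1r ?gt_eqF.
Qed.

(** A sublinear functional below [q] (take [t = 0]) whose value at [- y] is at
    most [- q y] (take [t = 1]); it differs from [q] unless [q (- y) = - q y]. *)
Definition lower_along q y x : R :=
  inf [set q (x + t *: y) - t * q y | t in [set t | 0 <= t]].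

Lemma lower_along_le q y x t : sublinear q -> 0 <= t ->
  lower_along q y x <= q (x + t *: y) - t * q y.
Proof.
move=> sq t0; apply: ge_inf; last by exists t.
exists (- q (- x)) => _ [s /= s0 <-].
have := sq.1 (x + s *: y) (- x); rewrite addrAC subrr add0r sq.2//; lra.
Qed.

Lemma lower_along_ge q y x c :
  (forall t, 0 <= t -> c <= q (x + t *: y) - t * q y) -> c <= lower_along q y x.
Proof.
move=> h; apply: lb_le_inf; last by move=> _ [t /= t0 <-]; exact: h.
by exists (q (x + 0 *: y) - 0 * q y), 0 => /=.
Qed.

Lemma lower_along_sublinear q y : sublinear q -> sublinear (lower_along q y).
Proof.
move=> sq; apply: le_sublinear.
- apply/eqP; rewrite eq_le; apply/andP; split.
    by apply: le_trans (lower_along_le y 0 sq (lexx 0)) _;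
       rewrite scale0r addr0 mul0r subr0 sublinear0.
  by apply: lower_along_ge => t t0; rewrite add0r sq.2// subrr.
- move=> x z; rewrite -lerBlDr; apply: lower_along_ge => s s0.
  rewrite lerBlDr -lerBlDl; apply: lower_along_ge => t t0; rewrite lerBlDl.
  apply: le_trans (lower_along_le y _ sq (addr_ge0 s0 t0)) _.
  have := sq.1 (x + s *: y) (z + t *: y).
  by rewrite addrACA -scalerDl => h; lra.
- move=> t x t0; rewrite -ler_pdivrMl//; apply: lower_along_ge => s s0.
  rewrite ler_pdivrMl// mulrBr -(sq.2 t) ?(ltW t0)// mulrA scalerDr scalerA.
  by apply: lower_along_le => //; rewrite mulr_ge0// ltW.
Qed.

(** A chain of sublinear functionals has its infimum as a lower bound, so Zorn
    applies; a minimal [q] equals every [lower_along q y], hence is odd. *)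
Lemma minimal_sublinear p : sublinear p ->
  exists q, [/\ sublinear q, forall x, q x <= p x &
    forall r, sublinear r -> (forall x, r x <= q x) -> forall x, r x = q x].
Proof.
move=> sp; pose T := {q : V -> R | sublinear q /\ forall x, q x <= p x}.
pose r (a b : T) : bool := `[< forall x, sval b x <= sval a x >].
have : exists t : T, forall s, r t s -> s = t.
  apply: Zorn.
  - by move=> t; apply/asboolP.
  - move=> a b c /asboolP ab /asboolP bc; apply/asboolP => x.
    exact: le_trans (bc x) (ab x).
  - move=> [a ha] [b hb] /asboolP/= ab /asboolP/= ba; apply/eq_exist/funext => x.
    by apply/eqP; rewrite eq_le ab ba.
  move=> A Atot; have [[a0 Aa0]|A0] := pselect (A !=set0); last first.
    exists (exist _ p (conj sp (fun=> lexx _))) => s As.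
    by case: A0; exists s.
  pose B x := [set sval a x | a in A].
  have Blb x : has_lbound (B x).
    exists (- p (- x)) => _ [[a [sa ap]] Aa <-] /=.
    by apply: le_trans (sublinear_ge _ sa); rewrite lerN2.
  have infle x a : A a -> inf (B x) <= sval a x.
    by move=> Aa; apply: ge_inf => //; exists a.
  have infge x c : (forall a, A a -> c <= sval a x) -> c <= inf (B x).
    move=> h; apply: lb_le_inf; first by exists (sval a0 x), a0.
    by move=> _ [a Aa <-]; exact: h.
  have sB : sublinear (fun x => inf (B x)).
    apply: le_sublinear.
    - apply/eqP; rewrite eq_le; apply/andP; split.
        by apply: le_trans (infle _ _ Aa0) _; rewrite sublinear0//; case: (svalP a0).
      by apply: (infge) => a Aa; rewrite sublinear0//; case: (svalP a).
    - move=> x y; rewrite -lerBlDr; apply: (infge) => a Aa.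
      rewrite lerBlDr -lerBlDl; apply: (infge) => b Ab; rewrite lerBlDl.
      have [/asboolP h|/asboolP h] := Atot _ _ Aa Ab.
        apply: le_trans (infle _ _ Ab) _.
        by apply: le_trans ((svalP b).1.1 x y) _; rewrite lerD2r.
      apply: le_trans (infle _ _ Aa) _.
      by apply: le_trans ((svalP a).1.1 x y) _; rewrite lerD2l.
    - move=> t x t0; rewrite -ler_pdivrMl//; apply: (infge) => a Aa.
      by rewrite ler_pdivrMl// -(svalP a).1.2 ?infle// ltW.
  have Bp x : inf (B x) <= p x by apply: le_trans (infle x _ Aa0) _; apply: (svalP a0).2.
  exists (exist _ (fun x => inf (B x)) (conj sB Bp)) => a Aa.
  by apply/asboolP => x /=; exact: infle.
move=> [[q [sq qp]] qmin]; exists q; split=> // s ss sq' x.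
have sp' y : s y <= p y by apply: le_trans (sq' y) (qp y).
by have /(_ _)/(congr1 sval)/= <- := qmin (exist _ s (conj ss sp')) _; last exact/asboolP.
Qed.

(** A minimal functional below [lower_along p z], rather than below [p], is at
    most [- p z] at [- z], so that being odd it reaches [p z] at [z]. *)
Lemma hahn_banach p z : sublinear p ->
  exists l : V -> R^o, [/\ linear l, forall x, l x <= p x & l z = p z].
Proof.
move=> sp; have [l [sl lp lmin]] := minimal_sublinear (lower_along_sublinear z sp).
have lower q y t : sublinear q -> 0 <= t -> lower_along q y (- (t *: y)) <= - (t * q y).
  move=> sq t0; apply: le_trans (lower_along_le y _ sq t0) _.
  by rewrite addNr sublinear0// sub0r.
have lodd x : l (- x) = - l x.
  apply/eqP; rewrite eq_le; apply/andP; split; last first.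
    by rewrite lerNl sublinear_ge.
  have <- : lower_along l x (- x) = l (- x).
    apply: lmin; first exact: lower_along_sublinear.
    move=> y; apply: le_trans (lower_along_le x y sl (lexx 0)) _.
    by rewrite scale0r addr0 mul0r subr0.
  by have := lower l x 1 sl ler01; rewrite scale1r mul1r.
have lD x y : l (x + y) = l x + l y.
  apply/eqP; rewrite eq_le sl.1/=.
  have := sl.1 (x + y) (- y); rewrite addrK lodd; lra.
have lpp x : l x <= p x.
  apply: le_trans (lp x) _; apply: le_trans (lower_along_le z x sp (lexx 0)) _.
  by rewrite scale0r addr0 mul0r subr0.
exists l; split=> //.
  move=> t x y; rewrite lD; congr (_ + _).
  have [t0|t0] := leP 0 t; first exact: sl.2.
  rewrite -[t in LHS]opprK scaleNr lodd sl.2 ?oppr_ge0 1?ltW//.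
  by rewrite mulNr opprK.
apply/eqP; rewrite eq_le lpp/= -[l z]opprK lerNr -lodd.
apply: le_trans (lp _) _.
by have := lower p z 1 sp ler01; rewrite scale1r mul1r.
Qed.

End sublinear_functionals.

(** * The dual space *)

Section dual_space.
Variables (R : realType) (V : normedModType R).
Implicit Types (f g : dual V) (x y : V).

Lemma bounded_dual (l : V -> R^o) (M : R) : linear l ->
  (forall x, `|l x| <= M * `|x|) -> exists f : dual V, (f : V -> R^o) = l.
Proof.
move=> ll lM.
pose L : {linear V -> R^o} := HB.pack l (GRing.isLinear.Build R V R^o *:%R l ll).
suff lc : l \in @continuous_linear R V by exists (Dual lc).
apply/continuous_linearP; split=> //.
apply: (@bounded_linear_continuous _ _ _ L); apply/linear_boundedP.
exists M; split; first exact: num_real.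
by move=> r /ltW Mr x; apply: le_trans (lM x) _; apply: ler_wpM2r.
Qed.

Lemma le_dual_norm f x : `|f x| <= `|f| * `|x|.
Proof. exact: dual_norm_bound. Qed.

Lemma dual_le_norm f x : `|x| <= 1 -> f x <= `|f|.
Proof. by move=> x1; apply: le_trans (ler_norm _) (dual_norm_ub f x1). Qed.

Lemma norm_dual_le f (M : R) : 0 <= M -> (forall x, `|f x| <= M * `|x|) -> `|f| <= M.
Proof.
move=> M0 fM; apply: dual_norm_le => x x1.
by apply: le_trans (fM x) _; rewrite ler_piMr.
Qed.

Lemma dual_norm_gt f (c : R) : 0 <= c -> c < `|f| -> exists x, `|x| <= 1 /\ c < f x.
Proof.
move=> c0 cf; have [] := @sup_gt _ _ c (dual_norm_has_sup f).1 cf.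
move=> _ [x /= x1 <-] cx.
have [fx0|fx0] := leP 0 (f x); first by exists x; rewrite ger0_norm in cx.
by exists (- x); rewrite normrN linearN; rewrite ltr0_norm in cx.
Qed.

Lemma dual_norming x : exists f : dual V, `|f| <= 1 /\ f x = `|x|.
Proof.
have sn : sublinear (fun y : V => `|y|).
  by split=> [y z|t y t0]; [exact: ler_normD | rewrite normrZ ger0_norm].
have [l [ll ln lx]] := hahn_banach x sn.
pose L : {linear V -> R^o} := HB.pack l (GRing.isLinear.Build R V R^o *:%R l ll).
have lM y : `|l y| <= 1 * `|y|.
  rewrite mul1r ler_norml ln andbT lerNl -normrN.
  by rewrite -[- l y]/(- L y) -linearN ln.
have [f fl] := bounded_dual ll lM.
by exists f; rewrite fl; split=> //; apply: norm_dual_le => // y; rewrite fl.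
Qed.

(** The limit is taken pointwise; [lim_le] keeps the Cauchy estimates uniform on
    the unit ball. *)
Lemma dual_cauchy_cvg (F : set_system (dual V)) :
  ProperFilter F -> cauchy F -> cvg F.
Proof.
move=> FF /cauchyP Fc.
have nearF e : 0 < e -> exists f0, F [set f : dual V | forall x, `|f0 x - f x| <= e * `|x|].
  move=> e0; have [f0 Ff0] := Fc _ e0; exists f0; apply: filterS Ff0 => f.
  rewrite -ball_normE /= => ff x; apply: le_trans (le_dual_norm (f0 - f) x) _.
  by rewrite ler_wpM2r// ltW.
have ev x : cvg ((fun f : dual V => f x : R^o) @ F).
  apply/cauchy_cvgP/cauchy_exP => e e0.
  have e1 : 0 < e / (`|x| + 1) by rewrite divr_gt0// ltr_wpDl.
  have [f0 Ff0] := nearF _ e1; exists (f0 x).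
  change (F (fun f : dual V => ball (f0 x : R^o) e (f x : R^o))).
  apply: filterS Ff0 => f /(_ x) ff; rewrite -ball_normE /=; apply: le_lt_trans ff _.
  by rewrite mulrAC ltr_pdivrMr ?ltr_wpDl// ltr_pM2l// ltrDl.
pose l x : R^o := lim ((fun f : dual V => f x : R^o) @ F).
have lim_le e f0 : F [set f : dual V | forall x, `|f0 x - f x| <= e * `|x|] ->
    forall x, `|f0 x - l x| <= e * `|x|.
  move=> Ff0 x; have cx : (fun f : dual V => `|f0 x - f x|) @ F --> `|f0 x - l x|.
    by apply: cvg_norm; apply: cvgB; [exact: cvg_cst | exact: ev].
  apply: (cvgr_to_le cx).
  by apply: filterS Ff0.
have ll : linear l.
  move=> a x y; apply: (@cvg_unique _ _ ((fun f : dual V => f (a *: x + y) : R^o) @ F)) => //.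
    exact: ev.
  have -> : (fun f : dual V => f (a *: x + y) : R^o) = (fun f => a *: (f x : R^o) + f y).
    by apply/funext => f; rewrite linearP.
  by apply: cvgD; [apply: cvgZr; exact: ev | exact: ev].
have [f1 /lim_le lf1] := nearF 1 ltr01.
have [g gl] : exists g : dual V, (g : V -> R^o) = l.
  apply: (bounded_dual (M := `|f1| + 1)) => // x.
  rewrite mulrDl -[l x](subrK (f1 x)); apply: le_trans (ler_normD _ _) _.
  by rewrite addrC lerD// ?le_dual_norm// distrC.
apply/cvg_ex; exists g; apply/cvg_ballP => e e0.
have [|f0 Ff0] := nearF (e / 4); first by rewrite divr_gt0.
apply: filterS (Ff0) => f ff; rewrite -ball_normE /=.
suff : `|g - f| <= e / 2 by move=> h; apply: le_lt_trans h _; lra.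
apply: norm_dual_le => [|x]; first by lra.
have := ff x; have := lim_le _ _ Ff0 x; rewrite -gl => h1 h2.
have -> : (g - f) x = (f0 x - f x) - (f0 x - g x) by rewrite opprB [RHS]addrC addrA subrK.
apply: le_trans (ler_normB _ _) _; lra.
Qed.

HB.instance Definition _ := Uniform_isComplete.Build (dual V) dual_cauchy_cvg.

End dual_space.

(** * The canonical embedding into the bidual *)

Section bidual.
Variables (R : realType) (V : normedModType R).
Implicit Types (f : dual V) (F : dual (dual V)) (x y : V).

Lemma bidual_evalZ a x : bidual_eval (a *: x) = a *: bidual_eval x.
Proof. by apply: dual_ext => f /=; exact: linearZ. Qed.

Lemma bidual_evalB x y : bidual_eval (x - y) = bidual_eval x - bidual_eval y.
Proof. by apply: dual_ext => f /=; exact: linearB. Qed.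

(** Hahn-Banach provides the lower bound. *)
Lemma norm_bidual_eval x : `|bidual_eval x| = `|x|.
Proof.
apply/eqP; rewrite eq_le; apply/andP; split.
  by apply: norm_dual_le => // f; rewrite mulrC; exact: (le_dual_norm f x).
have [f [f1 <-]] := dual_norming x.
exact: (@dual_le_norm _ _ (bidual_eval x) f f1).
Qed.

End bidual.

(** Completeness makes the isometric image of the space closed in its bidual. *)
Lemma nonreflexive_dist (R : realType) (V : completeNormedModType R) :
  ~ reflexive_space V ->
  exists (F : dual (dual V)) (t : R), [/\ 0 < t, `|F| <= 1 &
    forall x, t <= `|F - bidual_eval x|].
Proof.
move=> nr.
have [F [t [t0 Ft]]] : exists (F : dual (dual V)) (t : R), 0 < t /\
    forall x, t <= `|F - bidual_eval x|; last first.
  (* Normalizing [F] only rescales its distance to the canonical image. *)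
  have F0 : 0 < `|F|.
    by apply: lt_le_trans t0 _; have := Ft 0; rewrite -(scale0r 0) bidual_evalZ scale0r subr0.
  have N0 : `|F| != 0 by rewrite gt_eqF.
  exists (`|F|^-1 *: F), (`|F|^-1 * t); split.
  - by rewrite mulr_gt0// invr_gt0.
  - by rewrite normrZ ger0_norm ?invr_ge0// mulVf.
  - move=> x; have -> : bidual_eval x = `|F|^-1 *: bidual_eval (`|F| *: x).
      by rewrite bidual_evalZ scalerA mulVf// scale1r.
    by rewrite -scalerBr normrZ ger0_norm ?invr_ge0// ler_pM2l ?invr_gt0.
apply: contrapT => H; apply: nr; apply/seteqP; split=> // F _.
have near0 (t : R) : 0 < t -> exists x, `|F - bidual_eval x| < t.
  move=> t0; apply: contrapT => nt; apply: H; exists F, t; split=> // x.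
  by rewrite leNgt; apply/negP => ?; apply: nt; exists x.
have /choice[u uF] : forall n : nat, exists x, `|F - bidual_eval x| < n.+1%:R^-1.
  by move=> n; apply: near0; rewrite invr_gt0.
have uu n m : (n <= m)%N -> `|u n - u m| <= 2 * n.+1%:R^-1.
  move=> nm; rewrite -norm_bidual_eval bidual_evalB.
  have -> : bidual_eval (u n) - bidual_eval (u m) =
      (F - bidual_eval (u m)) - (F - bidual_eval (u n)).
    by rewrite opprB [RHS]addrC addrA subrK.
  apply: le_trans (ler_normB _ _) _; rewrite mulr_natl mulr2n.
  rewrite lerD ?(ltW (uF n))//; apply: le_trans (ltW (uF m)) _.
  by rewrite lef_pV2 ?posrE// ler_nat.
have invn (e : R) : 0 < e -> \forall n \near \oo, n.+1%:R^-1 < e.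
  by move=> e0; exact: near_infty_natSinv_lt (PosNum e0).
have ucvg : cvg (u @ \oo).
  apply/cauchy_cvgP/cauchy_exP => e e0.
  have [|N _ /(_ N (leqnn _)) /= Ne] := invn (e / 2); first by rewrite divr_gt0.
  exists (u N), N => // n /= Nn; rewrite -ball_normE /=.
  by apply: le_lt_trans (uu _ _ Nn) _; rewrite -ltr_pdivlMl// mulrC.
have [x ux] := (cvg_ex _).1 ucvg.
exists x => //; apply/esym/eqP; rewrite -subr_eq0 -normr_le0.
apply/ler_addgt0Pl => e e0; rewrite addr0.
near \oo => n.
have -> : F - bidual_eval x = (F - bidual_eval (u n)) + bidual_eval (u n - x).
  by rewrite bidual_evalB addrA subrK.
apply: le_trans (ler_normD _ _) _; rewrite norm_bidual_eval (splitr e).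
apply: lerD; last first.
  by near: n; apply: cvgr_distC_le => //; rewrite divr_gt0.
apply: le_trans (ltW (uF n)) _; apply: ltW.
by near: n; apply: invn; rewrite divr_gt0.
Unshelve. all: by end_near. Qed.

(** * James' sequence in a nonreflexive space *)

(** Otherwise the squared distance to [p] has a positive infimum [d] over the
    image of [C]; at a near-minimizer [c0] the residual [u c0 - p] would separate
    [p] from that image. Only near-minimizers are used, so no compactness. *)
Lemma convex_approx (R : realType) (T : lmodType R) (C : set T) (I : eqType)
    (s : seq I) (u : I -> T -> R) (p : I -> R) (e : R) :
  C !=set0 ->
  (forall x y t, 0 <= t -> t <= 1 -> C x -> C y -> C (t *: x + (1 - t) *: y)) ->
  (forall i a b x y, u i (a *: x + b *: y) = a * u i x + b * u i y) ->
  (forall i, exists M, forall x, C x -> `|u i x| <= M) ->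
  (forall (a : I -> R) d, 0 < d -> exists x, C x /\
    \sum_(i <- s) a i * p i - d <= \sum_(i <- s) a i * u i x) ->
  0 < e ->
  exists x, C x /\ forall i, i \in s -> `|u i x - p i| < e.
Proof.
move=> [x0 Cx0] Cconv ulin ubd sep e0.
pose Q x := \sum_(i <- s) (u i x - p i) ^+ 2.
have Q0 x : 0 <= Q x by apply: sumr_ge0 => i _; exact: sqr_ge0.
have [B QB] : exists B, forall x, C x -> Q x <= B.
  rewrite /Q; elim: s {Q Q0 sep} => [|i s [B sB]].
    by exists 0 => x _; rewrite big_nil.
  have [M uM] := ubd i; exists ((M + `|p i|) ^+ 2 + B) => x Cx.
  rewrite big_cons lerD ?sB// -real_normK ?num_real//.
  rewrite ler_sqr ?nnegrE//; first by rewrite (le_trans (ler_normB _ _))// lerD2r uM.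
  by rewrite addr_ge0// (le_trans _ (uM _ Cx)).
have hQ : has_inf (Q @` C).
  by split; [exists (Q x0), x0 | exists 0 => _ [x _ <-]].
pose d := inf (Q @` C).
have dQ x : C x -> d <= Q x by move=> Cx; apply: ge_inf; [case: hQ | exists x].
have near_min h : 0 < h -> exists2 x, C x & Q x < d + h.
  move=> h0; have [] := @inf_lt _ _ (d + h) hQ.1; first by rewrite ltrDl.
  by move=> _ [x Cx <-] ?; exists x.
have [dle0|d0] := leP d 0.
  have [|x Cx Qx] := near_min (e ^+ 2); first exact: exprn_gt0.
  exists x; split=> // i si; rewrite -ltr_sqr ?nnegrE ?(ltW e0)// real_normK ?num_real//.
  apply: le_lt_trans (_ : _ <= Q x) _; last by apply: lt_le_trans Qx _; rewrite gerDr.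
  by rewrite /Q (big_rem i)//= lerDl sumr_ge0// => j _; exact: sqr_ge0.
exfalso.
have B0 : 0 <= B by apply: le_trans (Q0 x0) (QB _ Cx0).
(* Moving from [c0] towards [c] by this proportion lowers [Q] below [d]: the
   first-order gain [2 t d] beats the second-order terms and the error [t ^+ 2]. *)
pose t := d / (d + B + 2).
have dB : 0 < d + B + 2 by lra.
have td : t * (d + B + 2) = d by rewrite /t divfK ?gt_eqF.
have t0 : 0 < t by rewrite divr_gt0.
have t1 : t <= 1 by rewrite ler_pdivrMr//; lra.
have t20 : 0 < t ^+ 2 by rewrite exprn_gt0.
have [c0 Cc0 Qc0] := near_min _ t20.
have [c [Cc sepc]] := sep (fun i => - (u i c0 - p i)) _ t20.
pose ip := \sum_(i <- s) (u i c0 - p i) * (u i c - p i).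
have ipt : ip <= t ^+ 2.
  move: sepc; rewrite lerBlDr -lerBlDl -sumrB; apply: le_trans.
  rewrite le_eqVlt; apply/orP; left; apply/eqP; apply: eq_bigr => i _; ring.
have := dQ _ (Cconv _ _ _ (ltW t0) t1 Cc Cc0).
have -> : Q (t *: c + (1 - t) *: c0) =
    t ^+ 2 * Q c + (1 - t) ^+ 2 * Q c0 + 2 * t * (1 - t) * ip.
  rewrite /Q /ip !mulr_sumr -!big_split/=; apply: eq_bigr => i _.
  rewrite ulin; ring.
apply/negP; rewrite -ltNge.
have QcB := QB _ Cc.
have h1 : t ^+ 2 * Q c <= t ^+ 2 * B by rewrite ler_wpM2l// ltW.
have h2 : (1 - t) ^+ 2 * Q c0 <= (1 - t) ^+ 2 * (d + t ^+ 2).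
  by rewrite ler_wpM2l ?sqr_ge0// ltW.
have h3 : 2 * t * (1 - t) * ip <= 2 * t * (1 - t) * t ^+ 2.
  by rewrite ler_wpM2l// mulr_ge0 ?subr_ge0// mulr_ge0// ltW.
apply: le_lt_trans (lerD (lerD h1 h2) h3) _.
have -> : t ^+ 2 * B + (1 - t) ^+ 2 * (d + t ^+ 2) + 2 * t * (1 - t) * t ^+ 2 =
  d + t * (t * (d + B + 2) - 2 * d) - t ^+ 2 * (1 + t ^+ 2) by ring.
rewrite td.
have : 0 <= t ^+ 2 * (1 + t ^+ 2) by rewrite mulr_ge0 ?addr_ge0 ?sqr_ge0.
have : 0 < t * d by rewrite mulr_gt0.
lra.
Qed.

Section james_sequence.
Variables (R : realType) (V : normedModType R).
Implicit Types (f : dual V) (F : dual (dual V)) (x y : V).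

Lemma dual_eval_comb (W : normedModType R) (f : dual W) (a b : R) (x y : W) :
  f (a *: x + b *: y) = a * f x + b * f y.
Proof. by rewrite linearP linearZ. Qed.

Lemma unit_ball_convex (W : normedModType R) (x y : W) (t : R) :
  0 <= t -> t <= 1 -> `|x| <= 1 -> `|y| <= 1 -> `|t *: x + (1 - t) *: y| <= 1.
Proof.
move=> t0 t1 x1 y1; apply: le_trans (ler_normD _ _) _.
rewrite !normrZ !ger0_norm ?subr_ge0//.
have := ler_wpM2l t0 x1; have : 0 <= 1 - t by rewrite subr_ge0.
by move=> /ler_wpM2l/(_ _ _ y1); lra.
Qed.

Lemma dual_lin_comb (W : normedModType R) (f : dual W) (I : Type) (s : seq I)
    (a : I -> R) (w : I -> W) :
  f (\sum_(i <- s) a i *: w i) = \sum_(i <- s) a i * f (w i).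
Proof. by rewrite linear_sum; apply: eq_bigr => i _; rewrite linearZ. Qed.

(** The solvability condition of [convex_approx] is that [F] evaluated at a
    combination [g] of the given functionals is at most the norm of [g]. *)
Lemma goldstine F (s : seq (dual V)) (e : R) : `|F| <= 1 -> 0 < e ->
  exists x, `|x| <= 1 /\ forall f, f \in s -> `|f x - F f| < e.
Proof.
move=> F1 e0.
apply: (@convex_approx _ _ [set x : V | `|x| <= 1] _ s (fun f x => f x) (fun f => F f)) => //.
- by exists 0; rewrite /= normr0.
- by move=> x y t t0 t1; exact: unit_ball_convex.
- by move=> f a b x y; exact: dual_eval_comb.
- by move=> f; exists `|f| => x x1; exact: dual_norm_ub.
move=> a d d0; pose g : dual V := \sum_(f <- s) a f *: f.
have gE x : g x = \sum_(f <- s) a f * f x.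
  exact: (@dual_lin_comb _ (bidual_eval x) _ s a id).
have -> : \sum_(f <- s) a f * F f = F g by rewrite (@dual_lin_comb _ F _ s a id).
have Fg : F g <= `|g|.
  apply: le_trans (ler_norm _) _; apply: le_trans (le_dual_norm F g) _.
  by rewrite ler_piMl.
have [g0|g0] := leP d `|g|; last first.
  by exists 0; rewrite /= normr0 -gE linear0; split=> //; lra.
have [||x [x1 xg]] := @dual_norm_gt _ _ g (`|g| - d); [lra..|].
by exists x; rewrite -gE; split=> //; lra.
Qed.

(** Helly: if [F] stays at distance [t] from the canonical image, then [t] is
    dominated by the norm of every [F + bidual_eval x], and [b * t] by that of
    every [b *: F + bidual_eval x]. This is the condition of [convex_approx] for
    solving [F f = t] and [f x = 0] approximately in the dual ball. *)
Lemma helly F (t : R) (s : seq V) (e : R) :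
  0 < t -> (forall x, t <= `|F - bidual_eval x|) -> 0 < e ->
  exists f, [/\ `|f| <= 1, `|F f - t| < e & forall x, x \in s -> `|f x| < e].
Proof.
move=> t0 Ft e0.
pose w (i : option V) : dual (dual V) := if i is Some x then bidual_eval x else F.
pose p (i : option V) : R := if i is Some x then 0 else t.
suff [f [f1 fs]] : exists f : dual V, `|f| <= 1 /\
    forall i, i \in None :: map Some s -> `|w i f - p i| < e.
  exists f; split=> //; first exact: (fs None (mem_head _ _)).
  move=> x xs; rewrite -[f x]subr0; apply: (fs (Some x)).
  by rewrite inE/= mem_map// => ? ? [].
apply: (@convex_approx _ _ [set f : dual V | `|f| <= 1] _ _ (fun i f => w i f) p) => //.
- by exists 0; rewrite /= normr0.
- by move=> f g r r0 r1; exact: unit_ball_convex.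
- by move=> i a b f g; exact: dual_eval_comb.
- by move=> i; exists `|w i| => f f1; exact: dual_norm_ub.
move=> a d d0; rewrite big_cons big_map/= [X in _ + X - d]big1 ?addr0; last first.
  by move=> x _; rewrite mulr0.
pose b := a None; rewrite -/b; pose y := \sum_(x <- s) a (Some x) *: x.
pose G : dual (dual V) := b *: F + bidual_eval y.
have GE f : \sum_(i <- None :: map Some s) a i * w i f = G f.
  rewrite big_cons big_map/=.
  by rewrite -(@dual_lin_comb V f _ s (fun x => a (Some x)) id).
have bG : b * t <= `|G|.
  have [b0|b0] := leP b 0; first by rewrite (le_trans _ (normr_ge0 _))// mulr_le0_ge0// ltW.
  have -> : G = b *: (F - bidual_eval (- b^-1 *: y)).
    rewrite scalerBr -bidual_evalZ scalerA mulrN mulfV ?gt_eqF// scaleN1r.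
    by rewrite -[- y]scaleN1r bidual_evalZ scaleN1r opprK.
  by rewrite normrZ gtr0_norm// ler_pM2l.
have [g0|g0] := leP d `|G|; last first.
  exists 0; rewrite /= normr0; split=> //; rewrite GE linear0; lra.
have [||f [f1 fG]] := @dual_norm_gt _ _ G (`|G| - d); [lra..|].
by exists f; split=> //; rewrite GE; apply: le_trans (ltW fG); rewrite lerD2r.
Qed.

(** The functionals are picked by [helly] and the points by [goldstine], each
    against the finite history, so that [f n] is almost null on earlier points
    while later points see every earlier [f n] as [F] does. *)
Lemma james_sequence F (t : R) :
  `|F| <= 1 -> 0 < t -> (forall x, t <= `|F - bidual_eval x|) ->
  exists (f : nat -> dual V) (x : nat -> V),
    [/\ forall n, `|f n| <= 1, forall n, `|x n| <= 1,
        forall n m, (n <= m)%N -> t / 2 <= f n (x m) &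
        forall n m, (m < n)%N -> `|f n (x m)| <= n.+1%:R^-1].
Proof.
move=> F1 t0 Ft.
pose good (s : seq (dual V * V)) (z : dual V * V) :=
  [/\ `|z.1| <= 1, `|z.2| <= 1, `|F z.1 - t| < t / 4,
      forall w, w \in s -> `|z.1 w.2| <= (size s).+1%:R^-1 &
      forall g, g \in z.1 :: map fst s -> `|g z.2 - F g| < t / 4].
have /choice[next nextP] : forall s, exists z, good s z.
  move=> s; pose e := Num.min (t / 4) (size s).+1%:R^-1.
  have e0 : 0 < e by rewrite lt_min divr_gt0// invr_gt0 ltr0Sn.
  have [g [g1 gF gs]] := helly (map snd s) t0 Ft e0.
  have [|y [y1 yF]] := @goldstine F (g :: map fst s) (t / 4) F1.
    by rewrite divr_gt0.
  exists (g, y); split=> //=; first by apply: lt_le_trans gF _; rewrite ge_min lexx.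
  move=> w ws; apply/ltW/(lt_le_trans (gs w.2 _)); first exact: map_f.
  by rewrite ge_min lexx orbT.
pose hist n := iter n (fun s => rcons s (next s)) [::].
have size_hist n : size (hist n) = n by elim: n => //= n IH; rewrite size_rcons IH.
have mem_hist n m : (m < n)%N -> next (hist m) \in hist n.
  elim: n => //= n IH; rewrite ltnS mem_rcons inE leq_eqVlt.
  by move=> /predU1P[->|/IH ->]; rewrite ?eqxx ?orbT.
exists (fun n => (next (hist n)).1), (fun n => (next (hist n)).2); split.
- by move=> n; have [] := nextP (hist n).
- by move=> n; have [] := nextP (hist n).
- move=> n m nm.
  have [_ _ Fn _ _] := nextP (hist n); have [_ _ _ _ Gm] := nextP (hist m).
  have : `|(next (hist n)).1 (next (hist m)).2 - F (next (hist n)).1| < t / 4.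
    apply: Gm; rewrite inE; move: nm; rewrite leq_eqVlt => /predU1P[->|nm].
      by rewrite eqxx.
    by rewrite map_f ?orbT// mem_hist.
  move: Fn; rewrite !ltr_norml => /andP[h1 _] /andP[h2 _]; lra.
- move=> n m mn; have [_ _ _ + _] := nextP (hist n).
  by rewrite size_hist; apply; exact: mem_hist.
Qed.

End james_sequence.

(** * Simons' inequality *)

(** Let [r n = 2 ^- n]. The points [g n] of [C n] are chosen one after the other
    so that [g n] nearly minimizes [p] on [s n + r n *: C n], where [s n] is the
    sum of the [r k.+1 *: g k] for [k < n]; the limit [h] is the sum of the whole
    series. As [h] differs from [s n] by [r n] times a limit of points of [C n],
    it suffices to bound [p h - p (s n)] below by about [r n * c]. By minimality
    [p (v n)], for [v n = s n + r n *: g n], is nearly increasing, so it is at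
    most [p h] up to a small error; and [s n.+1] is the midpoint of [s n] and
    [v n], so the gap between [p h] and [p (s n)] loses hardly more than half of
    itself at each step, starting from [p h]. *)
Lemma simons (R : realType) (X : completeNormedModType R) (C : nat -> set X)
    (p : X -> R) (L M c e : R) :
  (forall n, C n !=set0) -> (forall n, C n.+1 `<=` C n) ->
  (forall n x y, C n x -> C n y -> C n (2^-1 *: (x + y))) ->
  (forall x, C 0%N x -> `|x| <= M) ->
  sublinear p -> 0 <= L -> (forall x, p x <= L * `|x|) ->
  (forall x, C 0%N x -> c <= p x) -> 0 < e ->
  exists (v : nat -> X) (h : X), [/\ forall n, C 0%N (v n), v @ \oo --> h &
    forall l : dual X, (forall x, l x <= p x) -> l h = p h ->
    forall n, exists2 w, C n w & c - e <= l w].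
Proof.
move=> C0 CS Cmid CM sp L0 pL cp e0.
have Cle n m x : (n <= m)%N -> C m x -> C n x.
  by move=> /subnKC <-; elim: (m - n)%N => [|k IH]; rewrite ?addn0// addnS => /CS.
(* The choices of the [g n], the passage to the limit and the approximation of
   the tail of [h] by a point of [C n] cost 7 times [d] in total. *)
pose d := e / 7; have d0 : 0 < d by rewrite divr_gt0.
pose r n : R := 2^-1 ^+ n; pose eps n : R := d * 4^-1 ^+ n.
have r0 n : 0 < r n by rewrite exprn_gt0// invr_gt0.
have rS n : r n.+1 = r n / 2 by rewrite /r exprSr.
have eps0 n : 0 < eps n by rewrite mulr_gt0// exprn_gt0// invr_gt0.
have epsS n : eps n.+1 = eps n / 4 by rewrite /eps exprSr mulrA.
have near_min (z : X * nat) : exists g, C z.2 g /\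
    forall g', C z.2 g' -> p (z.1 + r z.2 *: g) <= p (z.1 + r z.2 *: g') + eps z.2.
  case: z => s n /=; pose A := [set p (s + r n *: g) | g in C n].
  have [g1 Cg1] := C0 n.
  have hA : has_inf A.
    split; first by exists (p (s + r n *: g1)), g1.
    exists (- (L * (`|s| + r n * M))) => _ [g Cg <-].
    apply: le_trans (sublinear_ge _ sp); rewrite lerN2; apply: le_trans (pL _) _.
    rewrite ler_wpM2l// normrN (le_trans (ler_normD _ _))// lerD2l normrZ.
    by rewrite gtr0_norm// ler_pM2l//; apply/CM/(Cle _ _ _ (leq0n n)).
  have [|_ [g Cg <-] gA] := @inf_lt _ A (inf A + eps n) hA.1; first by rewrite ltrDl.
  exists g; split=> // g' Cg'; apply: (le_trans (ltW gA)).
  by rewrite lerD2r; apply: ge_inf; [case: hA | exists g'].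
have /choice[G GP] := near_min.
pose s n := iteri n (fun n s => s + r n.+1 *: G (s, n)) 0.
pose g n := G (s n, n); pose v n := s n + r n *: g n.
have sS n : s n.+1 = s n + r n.+1 *: g n by [].
have Cg n : C n (g n) by have [] := GP (s n, n).
have vmin n w : C n w -> p (v n) <= p (s n + r n *: w) + eps n.
  by have [_] := GP (s n, n); exact.
have sv k : forall n, exists w, C n w /\ v (n + k)%N = s n + r n *: w.
  elim: k => [|k IH] n; first by exists (g n); rewrite addn0.
  have [w [Cw vw]] := IH n.+1; exists (2^-1 *: (g n + w)); split.
    by apply: Cmid => //; exact: CS.
  by rewrite addnS -addSn vw sS rS -addrA -scalerDr scalerA.
have pv n k : p (v n) <= p (v (n + k)%N) + 2 * (eps n - eps (n + k)%N).
  elim: k => [|k IH]; first by rewrite addn0; lra.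
  have [w [Cw vw]] := sv 1%N (n + k)%N; have := vmin _ _ Cw.
  rewrite -vw addn1 addnS epsS; have := eps0 (n + k)%N; lra.
have M0 : 0 <= M by have [x Cx] := C0 0%N; apply: le_trans (CM x Cx).
have CgM n : `|g n| <= M by apply/CM/(Cle _ _ _ (leq0n n)).
have vS n : v n - v n.+1 = r n.+1 *: (g n - g n.+1).
  rewrite /v sS scalerBr !opprD !addrA; congr (_ - _).
  rewrite [s n + _]addrC addrK -scalerBl; congr (_ *: _).
  by rewrite rS; field.
have vv n k : `|v n - v (n + k)%N| <= 2 * M * (r n - r (n + k)%N).
  elim: k => [|k IH]; first by rewrite addn0 !subrr normr0 mulr0.
  rewrite addnS -(subrK (v (n + k)%N) (v n)) -addrA.
  apply: le_trans (ler_normD _ _) _; rewrite vS normrZ gtr0_norm//.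
  have -> : 2 * M * (r n - r (n + k).+1) =
     2 * M * (r n - r (n + k)%N) + r (n + k).+1 * (M + M) by rewrite rS; field.
  rewrite lerD// ler_pM2l//.
  by apply: le_trans (ler_normB _ _) _; rewrite lerD.
have r_lt (a : R) : 0 < a -> \forall n \near \oo, r n < a.
  move=> a0; have /cvgr0Pnorm_lt : (fun n => r n) @ \oo --> (0 : R).
    have := @cvg_geometric R 1 (2^-1); rewrite ger0_norm// invf_lt1// ltr1n.
    by move=> /(_ isT); apply: cvg_trans; apply: near_eq_cvg; near=> n; rewrite /geometric/= mul1r.
  by move=> /(_ a a0); apply: filterS => n; rewrite gtr0_norm.
have vcvg : cvg (v @ \oo).
  apply/cauchy_cvgP/cauchy_exP => a a0.
  have aM : 0 < a / (2 * M + 1) by rewrite divr_gt0// ltr_wpDl// mulr_ge0.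
  have [N _ /(_ N (leqnn _)) /= rN] := r_lt _ aM.
  exists (v N), N => // n /= /subnKC <-; rewrite -ball_normE /=.
  apply: le_lt_trans (vv N _) _.
  have h1 : 2 * M * (r N - r (N + (n - N))%N) <= 2 * M * r N.
    by rewrite ler_wpM2l ?mulr_ge0// gerBl ltW.
  apply: le_lt_trans h1 _; move: rN; rewrite ltr_pdivlMr ?ltr_wpDl ?mulr_ge0// => rN.
  have := r0 N; lra.
have [h vh] := (cvg_ex _).1 vcvg.
have vh_near (a : R) : 0 < a -> exists N, forall n, (N <= n)%N -> `|v n - h| <= a.
  move=> a0; have [N _ NP] : \forall n \near \oo, `|v n - h| <= a.
    exact: cvgr_distC_le.
  by exists N => n /NP.
(* The errors [eps k] for [k >= n] add up to at most [2 * eps n]. *)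
have pvh n : p (v n) <= p h + 2 * eps n.
  apply/ler_addgt0Pr => a a0.
  have [|N NP] := vh_near (a / (L + 1)); first by rewrite divr_gt0// ltr_wpDl.
  have := NP (n + N)%N (leq_addl _ _); rewrite ler_pdivlMr ?ltr_wpDl// => hN.
  have := pv n N; have := sp.1 h (v (n + N)%N - h); rewrite subrKC.
  have := pL (v (n + N)%N - h); have := eps0 (n + N)%N.
  have := normr_ge0 (v (n + N)%N - h); lra.
have ps n : r n * (p h - 4 * d) + 4 * eps n <= p h - p (s n).
  elim: n => [|n IH]; first by rewrite /r /eps /s /= !expr0 sublinear0//; lra.
  have sE : s n.+1 = 2^-1 *: (s n + v n).
    rewrite sS /v addrA [RHS]scalerDr scalerA rS mulrC; congr (_ + _).
    by rewrite scalerDr -scalerDl -[LHS]scale1r; congr (_ *: _); lra.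
  have := sp.2 2^-1 (s n + v n); rewrite -sE invr_ge0 => /(_ (ler0n R 2)).
  have := sp.1 (s n) (v n); have := pvh n; rewrite rS epsS; lra.
have ph : c - 2 * d <= p h.
  have := pvh 0%N; rewrite /eps expr0 mulr1.
  suff : c <= p (v 0%N) by lra.
  by apply: cp; have [w [Cw ->]] := sv 0%N 0%N; rewrite /r expr0 scale1r add0r.
exists v, h; split=> //.
  by move=> n; have [w [Cw ->]] := sv n 0%N; rewrite /r expr0 scale1r add0r.
move=> l lp lh n.
have [|N NP] := vh_near (r n * d / (`|l| + 1)).
  by rewrite divr_gt0 ?mulr_gt0// ltr_wpDl.
have := NP (n + N)%N (leq_addl _ _); rewrite ler_pdivlMr ?ltr_wpDl// => hN.
have [w [Cw vw]] := sv N n; exists w => //.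
have l1 : l (v (n + N)%N) = l (s n) + r n * l w by rewrite vw linearD linearZ.
have l2 : - (`|l| * `|v (n + N)%N - h|) <= l (v (n + N)%N) - p h.
  rewrite -lh -linearB lerNl; apply: le_trans (ler_norm _) _.
  by rewrite normrN le_dual_norm.
suff : r n * (c - e) <= r n * l w by rewrite ler_pM2l.
have := ps n; have := lp (s n); have := eps0 n.
have : r n * (c - 6 * d) <= r n * (p h - 4 * d) by rewrite ler_pM2l//; lra.
have -> : e = 7 * d by rewrite /d; field.
have := normr_ge0 (v (n + N)%N - h); lra.
Unshelve. all: by end_near. Qed.

(** * Weak compactness *)

Section weak_topologies.
Variables (R : realType) (V : normedModType R).

Lemma weak_star_eval_continuous (x : V) :
  continuous (fun f : weak_star V => (f : dual V) x : R^o).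
Proof.
move=> f.
apply: (@continuous_comp (weak_star V) {ptws V -> R^o} R^o
  (fun f : dual V => (f : V -> R^o)) (@proj V (fun=> R^o) x)).
  exact: initial_continuous.
exact: proj_continuous.
Qed.

Lemma weak_dual_continuous (f : dual V) :
  continuous (fun x : weak V => f x : R^o).
Proof.
move=> x.
apply: (@continuous_comp (weak V) {ptws dual V -> R^o} R^o
  (fun x : V => (fun f : dual V => f x)) (@proj (dual V) (fun=> R^o) f)).
  exact: initial_continuous.
exact: proj_continuous.
Qed.

Lemma weakly_compact_max (D : set V) (f : dual V) :
  D !=set0 -> weakly_compact D -> exists2 d, D d & forall y, D y -> f y <= f d.
Proof.
move=> D0 cD; have [|d /set_mem Dd dmax] := @compact_EVT_max (weak V) R f D D0 cD.
  by apply: continuous_subspaceT => x; exact: weak_dual_continuous.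
by exists d => // y Dy; apply: dmax; exact/mem_set.
Qed.

(** The points of [D], seen as functionals on the complete dual space, are
    pointwise bounded, so Banach-Steinhaus applies. *)
Lemma weakly_compact_bounded (D : set V) :
  weakly_compact D -> exists2 K, 0 <= K & forall d, D d -> `|d| <= K.
Proof.
move=> cD; have [D0|D0] := pselect (D !=set0); last first.
  by exists 0 => // d Dd; case: D0; exists d.
have [] := @Banach_Steinhauss R (dual V) R^o
    [set l | exists2 d, D d & l = (fun f : dual V => f d : R^o)] _ _ 1.
- move=> _ [d Dd ->]; split=> // r; exists (r * `|d|) => f fr.
  by apply: le_trans (le_dual_norm f d) _; rewrite ler_wpM2r.
- move=> f; have [d Dd fd] := weakly_compact_max f D0 cD.
  have [e De fe] := weakly_compact_max (- f) D0 cD.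
  exists (`|f d| + `|f e|) => _ [y Dy ->].
  have := fd _ Dy; have := fe _ Dy; rewrite /= lerN2 => h1 h2.
  rewrite ler_norml; apply/andP; split.
    have := ler_norm (- f e); rewrite normrN; have := normr_ge0 (f d); lra.
  have := ler_norm (f d); have := normr_ge0 (f e); lra.
move=> K KD; exists `|K| => // d Dd.
have [f [f1 <-]] := dual_norming d.
apply: le_trans (ler_norm _) _; apply: le_trans (ler_norm K).
by apply: (KD (fun f : dual V => f d : R^o)) => //; exists d.
Qed.

End weak_topologies.

(** * Null sequences of convex blocks *)

Lemma disjoint_fsets_escape (A : nat -> {fset nat}) (K : nat) :
  (forall i j, i != j -> [disjoint A i & A j]%fset) ->
  exists N, forall n k, (N <= n)%N -> k \in A n -> (K <= k)%N.
Proof.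
move=> dA; elim: K => [|K [N IH]]; first by exists 0%N.
have [[n0 Kn0]|nK] := pselect (exists n, K \in A n); last first.
  exists N => n k Nn kA; rewrite ltn_neqAle (IH n)// andbT.
  by apply/eqP => Kk; apply: nK; exists n; rewrite Kk.
exists (maxn N n0.+1) => n k; rewrite geq_max => /andP[Nn n0n] kA.
rewrite ltn_neqAle (IH n)// andbT; apply/eqP => Kk.
have /fdisjointP/(_ K Kn0) : [disjoint A n0 & A n]%fset by apply: dA; rewrite ltn_eqF.
by rewrite Kk kA.
Qed.

(** The limit [l] of the blocks vanishes at every [x m], since a block uses only
    late [f k], and these are small at [x m]; subtracting [l] keeps the lower
    bound [b] at late points. *)
Lemma weak_star_null_sequence (R : realType) (V : normedModType R)
    (f : nat -> dual V) (x : nat -> V) (b : R) :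
  convex_block_compact ([set f : dual V | `|f| <= 1] : set (weak_star V)) ->
  (forall n, `|f n| <= 1) ->
  (forall n m, (n <= m)%N -> b <= f n (x m)) ->
  (forall n m, (m < n)%N -> `|f n (x m)| <= n.+1%:R^-1) ->
  exists h : nat -> dual V, [/\ forall n, `|h n| <= 2,
    forall y, (fun n => h n y : R^o) @ \oo --> (0 : R^o) &
    forall n, exists N, forall m, (N <= m)%N -> b <= h n (x m)].
Proof.
move=> cbc f1 fb fs.
have [y [[A [lam [dA lam0 yE]]] [l l1 yl]]] := cbc f f1.
have ylz z : (fun n => (y n : dual V) z : R^o) @ \oo --> ((l : dual V) z : R^o).
  have := @weak_star_eval_continuous R V z l.
  by apply: cvg_comp.
have yz n z : (y n : dual V) z = \sum_(k <- A n) lam k * f k z.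
  rewrite (yE n).1.
  exact: (@dual_lin_comb R (dual V) (bidual_eval z) _ (A n) lam f).
have y1 n : `|y n : dual V| <= 1.
  apply: norm_dual_le => // z; rewrite yz.
  apply: le_trans (ler_norm_sum _ _ _) _; rewrite -(yE n).2 mulr_suml.
  apply: ler_sum => k _; rewrite normrM ger0_norm// ler_wpM2l//.
  by apply: le_trans (le_dual_norm _ _) _; rewrite ler_piMl.
have yb n : exists N, forall m, (N <= m)%N -> b <= (y n : dual V) (x m).
  exists (\max_(k <- A n) k) => m Nm; rewrite yz -[leLHS]mul1r -(yE n).2 mulr_suml.
  rewrite big_seq [leRHS]big_seq; apply: ler_sum => k kA; rewrite ler_wpM2l// fb//.
  by apply: leq_trans Nm; rewrite (big_rem k)//= leq_maxl.
have lx m : (l : dual V) (x m) = 0.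
  apply/eqP; rewrite -normr_le0; apply/ler_addgt0Pl => e e0; rewrite addr0.
  apply: (cvgr_to_le (cvg_norm (ylz (x m)))).
  have [K _ /(_ K (leqnn _))/= Ke] := near_infty_natSinv_lt (PosNum e0).
  have [N NA] := disjoint_fsets_escape (maxn m.+1 K) dA.
  exists N => // n /= Nn; rewrite yz; apply: le_trans (ler_norm_sum _ _ _) _.
  rewrite -[e]mul1r -(yE n).2 mulr_suml big_seq [leRHS]big_seq.
  apply: ler_sum => k kA; rewrite normrM ger0_norm// ler_wpM2l//.
  have := NA n k Nn kA; rewrite geq_max => /andP[mk Kk].
  apply: le_trans (fs _ _ mk) _; apply: le_trans (ltW Ke).
  by rewrite lef_pV2 ?posrE// ler_nat.
exists (fun n => (y n : dual V) - (l : dual V)); split.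
- by move=> n; apply: le_trans (ler_normB _ _) _; rewrite (_ : 2 = 1 + 1)// lerD.
- move=> z; rewrite (_ : 0 = (l : dual V) z - (l : dual V) z); last by rewrite subrr.
  by apply: cvgB; [exact: ylz | exact: cvg_cst].
- move=> n; have [N NP] := yb n; exists N => m /NP bm.
  have -> : ((y n : dual V) - l : dual V) (x m) = (y n : dual V) (x m) - (l : dual V) (x m).
    by [].
  by rewrite lx subr0.
Qed.

(** * Perturbation by null convex sets *)

Section null_convex_sets.
Variables (R : realType) (V : normedModType R).
Implicit Types (C : nat -> set (dual V)) (f g : dual V) (x y : V).

(** What survives of a weak-star null sequence: [C n] plays the role of the convex
    hull of its terms of index at least [n]. Midpoint convexity is enough for
    [simons]. In [ncs_null] a one-sided bound suffices, since [y] can be replaced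
    with [- y]. *)
Record null_convex_sets C (M : R) := NullConvexSets {
  ncs_nonempty : forall n, C n !=set0 ;
  ncs_decr : forall n, C n.+1 `<=` C n ;
  ncs_mid : forall n f g, C n f -> C n g -> C n (2^-1 *: (f + g)) ;
  ncs_bound : forall f, C 0%N f -> `|f| <= M ;
  ncs_null : forall y (a : R), 0 < a -> exists N, forall f, C N f -> f y <= a }.

Lemma ncs_le C M n m : null_convex_sets C M -> (n <= m)%N -> C m `<=` C n.
Proof.
move=> CM /subnKC <-; elim: (m - n)%N => [|k IH] f; rewrite ?addn0// addnS.
by move=> /(ncs_decr CM)/IH.
Qed.

(** Instead of convex hulls, the sets are cut out by two conditions that pass to
    midpoints: the upper bounds common to all [h j], [n <= j], and the eventual
    lower bound [b] along [x]. *)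
Lemma null_sequence_sets (h : nat -> dual V) (x : nat -> V) (b : R) :
  (forall n, `|h n| <= 2) ->
  (forall y, (fun n => h n y : R^o) @ \oo --> (0 : R^o)) ->
  (forall n, exists N, forall m, (N <= m)%N -> b <= h n (x m)) ->
  (forall n, `|x n| <= 1) ->
  exists C, null_convex_sets C 2 /\ forall f, C 0%N f -> b <= `|f|.
Proof.
move=> h2 h0 hb x1.
exists (fun n => [set g : dual V |
  (forall y c, (forall j, (n <= j)%N -> h j y <= c) -> g y <= c) /\
  exists N, forall m, (N <= m)%N -> b <= g (x m)]); split; last first.
  move=> f [_ [N NP]]; apply: le_trans (NP N (leqnn _)) _.
  exact: dual_le_norm.
split.
- by move=> n; exists (h n); split=> // y c; apply.
- move=> n g [gP gb]; split=> // y c hc; apply: gP => j /ltnW; exact: hc.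
- move=> n f g [fP [Nf fb]] [gP [Ng gb]].
  have midE y : (2^-1 *: (f + g)) y = 2^-1 * (f y + g y) by [].
  split=> [y c hc|]; first by rewrite midE; have := fP y c hc; have := gP y c hc; lra.
  exists (maxn Nf Ng) => m; rewrite geq_max midE => /andP[/fb + /gb]; lra.
- move=> g [gP _].
  have g2 y : g y <= 2 * `|y|.
    apply: gP => j _; apply: le_trans (ler_norm _) _.
    by apply: le_trans (le_dual_norm _ _) _; rewrite ler_wpM2r.
  apply: norm_dual_le => // y; rewrite ler_norml g2 andbT lerNl.
  by rewrite -linearN -normrN g2.
- move=> y a a0.
  have [N _ NP] : \forall n \near \oo, h n y <= a by apply: (cvgr_le 0).
  by exists N => g [gP _]; apply: gP => j /NP.
Qed.

(** [simons] with [p] the support function of [D]: it is attained by weak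
    compactness, at points where the sets [C n] become small. *)
Lemma small_on_weakly_compact C (M : R) (D : set V) (e : R) :
  null_convex_sets C M -> weakly_compact D -> 0 < e ->
  forall n, exists2 g, C n g & forall d, D d -> g d <= e.
Proof.
move=> CM cD e0 n; apply: contrapT => nosmall.
have big g : C n g -> exists2 d, D d & e < g d.
  move=> Cg; apply: contrapT => nd; apply: nosmall; exists g => // d Dd.
  by rewrite leNgt; apply/negP => ?; apply: nd; exists d.
have [g0 Cg0] := ncs_nonempty CM n.
have D0 : D !=set0 by have [d Dd _] := big _ Cg0; exists d.
have [K K0 DK] := weakly_compact_bounded cD.
pose p (f : dual V) := sup [set f d | d in D].
have pmax f : exists2 d, D d & p f = f d.
  have [d Dd fd] := weakly_compact_max f D0 cD; exists d => //.
  apply/eqP; rewrite eq_le; apply/andP; split.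
    by apply: ge_sup; [exists (f d), d | move=> _ [y Dy <-]; exact: fd].
  by apply: sup_ubound; [exists (f d) => _ [y Dy <-]; exact: fd | exists d].
have pub f d : D d -> f d <= p f.
  move=> Dd; have [d' _ fd'] := weakly_compact_max f D0 cD.
  by apply: sup_ubound; [exists (f d') => _ [y Dy <-]; exact: fd' | exists d].
have psub : sublinear p.
  apply: le_sublinear.
  - by have [d _ ->] := pmax 0.
  - by move=> f g; have [d Dd ->] := pmax (f + g); rewrite lerD// pub.
  - move=> t f t0; have [d Dd ->] := pmax (t *: f).
    by rewrite (_ : (t *: f) d = t * f d)// ler_pM2l// pub.
have pK f : p f <= K * `|f|.
  have [d Dd ->] := pmax f; apply: le_trans (ler_norm _) _.
  by apply: le_trans (le_dual_norm _ _) _; rewrite mulrC ler_wpM2r// DK.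
have [|||||||||v [f [_ _ vf]]] :=
  @simons R (dual V) (fun k => C (n + k)%N) p K M e (e / 2) => //.
- by move=> k; exact: (ncs_nonempty CM).
- by move=> k; rewrite addnS; exact: (ncs_decr CM).
- by move=> k; exact: (ncs_mid CM).
- by move=> g Cg; apply: (ncs_bound CM); exact: (ncs_le CM) Cg.
- move=> g; rewrite addn0 => Cg; have [d Dd /ltW ed] := big _ Cg.
  exact: le_trans ed (pub _ _ Dd).
- by rewrite divr_gt0.
have [d Dd fd] := pmax f.
have [|N NP] := ncs_null CM d (a := e / 4); first by rewrite divr_gt0.
have [|w Cw] := vf (bidual_eval d) _ (esym fd) N; first by move=> g; exact: pub.
have /= := NP _ (ncs_le CM (leq_addl _ _) Cw); lra.
Qed.

(** The step [u] is so small that one step changes the norm by at most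
    [del / 4]; hence at the first multiple [t] of [u] for which the norms of
    [f0 + t g], [g] in some [C N], stay above [1 + del / 4], they can still be
    kept below [1 + del / 2]. If every limit of such functionals attained its
    norm at a point [x] of the ball, then by [simons] some [f0 x + t * g x], with
    [g] in arbitrarily late [C n], would exceed [1 + del / 8]; but [g x] becomes
    small and [f0 x <= 1]. *)
Lemma nonattaining_perturbation C (M b del : R) f0 :
  null_convex_sets C M -> 0 < b -> (forall f, C 0%N f -> b <= `|f|) ->
  `|f0| = 1 -> 0 < del ->
  exists2 t, 0 <= t & forall N, exists (v : nat -> dual V) (h : dual V),
    [/\ forall n, exists2 g, C N g & v n = f0 + t *: g,
        v @ \oo --> h, 1 <= `|h|, `|h| <= 1 + del & ~ norm_attaining h].
Proof.
move=> CM b0 Cb f01 del0.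
have M0 : 0 < M.
  have [g Cg] := ncs_nonempty CM 0%N.
  by apply: lt_le_trans b0 _; apply: le_trans (Cb _ Cg) (ncs_bound CM Cg).
have C0 n g : C n g -> C 0%N g by exact: (ncs_le CM).
pose u := del / 4 / M; have u0 : 0 < u by rewrite !divr_gt0.
have uM : u * M = del / 4 by rewrite divfK// gt_eqF.
pose above k := `[< exists N, forall g, C N g -> 1 + del / 4 <= `|f0 + (k%:R * u) *: g| >].
have ex_above : exists k, above k.
  pose k := (Num.truncn ((2 + del / 4) / (u * b))).+1.
  exists k; apply/asboolP; exists 0%N => g Cg.
  have kub : 2 + del / 4 <= k%:R * u * b.
    by rewrite -mulrA -ler_pdivrMr; [apply/ltW/truncnS_gt | rewrite mulr_gt0].
  have kg : k%:R * u * b <= k%:R * u * `|g|.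
    by rewrite ler_wpM2l ?Cb// mulr_ge0// ltW.
  have : `|(k%:R * u) *: g| <= `|f0 + (k%:R * u) *: g| + `|f0|.
    by apply: le_trans (ler_normB _ _); rewrite addrAC subrr add0r.
  rewrite normrZ (@ger0_norm _ (k%:R * u)) ?f01; last by rewrite mulr_ge0// ltW.
  lra.
case: (ex_minnP ex_above) => -[|k] /asboolP[N1 kN1] kmin.
  have [g Cg] := ncs_nonempty CM N1; have := kN1 _ Cg.
  by rewrite mul0r scale0r addr0 f01; lra.
have below N : exists2 g, C N g & `|f0 + (k.+1%:R * u) *: g| <= 1 + del / 2.
  have [g Cg gk] : exists2 g, C N g & `|f0 + (k%:R * u) *: g| < 1 + del / 4.
    apply: contrapT => H; have : above k.
      apply/asboolP; exists N => g Cg; rewrite leNgt; apply/negP => ?.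
      by apply: H; exists g.
    by move=> /kmin; rewrite ltnn.
  exists g => //; rewrite -natr1 mulrDl mul1r scalerDl addrA.
  apply: le_trans (ler_normD _ _) _; rewrite normrZ gtr0_norm//.
  have : u * `|g| <= u * M by rewrite ler_pM2l//; apply/(ncs_bound CM)/(C0 N).
  by rewrite uM; lra.
pose t := k.+1%:R * u; have t0 : 0 <= t by rewrite mulr_ge0// ltW.
rewrite -/t in kN1 below; exists t => // N0; pose N := maxn N0 N1.
pose B n := [set f | exists2 g, C (N + n)%N g & f = f0 + t *: g /\ `|f| <= 1 + del / 2].
have BN n f : B n f -> exists2 g, C N g & f = f0 + t *: g.
  by move=> [g Cg [-> _]]; exists g => //; apply: (ncs_le CM) Cg; exact: leq_addr.
have Bge n f : B n f -> 1 + del / 4 <= `|f|.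
  move=> /BN[g Cg ->]; apply: kN1; apply: (ncs_le CM) Cg; exact: leq_maxr.
have Ble n f : B n f -> `|f| <= 1 + del / 2 by case=> g _ [].
have [|||||||||v [h [Bv vh hP]]] := @simons R (dual V) B (fun f => `|f|) 1
    (1 + del / 2) (1 + del / 4) (del / 8).
- move=> n; have [g Cg gle] := below (N + n)%N.
  by exists (f0 + t *: g); exists g.
- move=> n f [g Cg fg]; exists g => //; apply: (ncs_decr CM); by rewrite -addnS.
- move=> n f f' [g Cg [fE fle]] [g' Cg' [fE' fle']].
  exists (2^-1 *: (g + g')); first exact: (ncs_mid CM).
  split.
    rewrite fE fE' addrACA -(scalerDr t g g') [LHS]scalerDr !scalerA mulrC.
    congr (_ + _); rewrite scalerDr -scalerDl -[RHS]scale1r.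
    by congr (_ *: _); lra.
  rewrite normrZ ger0_norm ?invr_ge0//; have := ler_normD f f'; lra.
- exact: Ble.
- by split=> [f g|a f a0]; [exact: ler_normD | rewrite normrZ ger0_norm].
- exact: ler01.
- by move=> f; rewrite mul1r.
- exact: Bge.
- by rewrite divr_gt0.
have nvh : (fun n => `|v n|) @ \oo --> `|h| by exact: cvg_norm.
exists v, h; split=> //.
- move=> n; have [g Cg ->] := BN _ _ (Bv n); exists g => //.
  by apply: (ncs_le CM) Cg; exact: leq_maxl.
- apply: (cvgr_to_ge nvh); apply: nearW => n; have := Bge _ _ (Bv n); lra.
- apply: (cvgr_to_le nvh); apply: nearW => n; have := Ble _ _ (Bv n); lra.
move=> [x [x1 hx]].
have [|n nP] := ncs_null CM x (a := del / 16 / (t + 1)).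
  by rewrite !divr_gt0// ltr_wpDl.
have [|w [g Cg [-> _]]] := hP (bidual_eval x) _ hx n.
  by move=> f; exact: (dual_le_norm f x1).
have /nP : C n g by apply: (ncs_le CM) Cg; exact: leq_addl.
rewrite ler_pdivlMr ?ltr_wpDl// => gx.
have tg : t * g x <= del / 16.
  have [g0|/ltW g0] := leP 0 (g x); first by lra.
  by apply: (@le_trans _ _ 0); [rewrite mulr_ge0_le0 | rewrite divr_ge0// ltW].
have : f0 x <= 1 by rewrite -f01; exact: dual_le_norm.
rewrite (_ : bidual_eval x (f0 + t *: g) = f0 x + t * g x)//; lra.
Qed.

End null_convex_sets.

(** * One-sided James' theorem *)

Lemma ereal_sup_lt_bound (R : realType) (T : Type) (D : set T) (f : T -> R) (alpha : R) :
  (ereal_sup [set (f d)%:E | d in D] < alpha%:E)%E ->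
  exists2 a, a < alpha & forall d, D d -> f d <= a.
Proof.
have ub d : D d -> ((f d)%:E <= ereal_sup [set (f d)%:E | d in D])%E.
  by move=> Dd; apply: ereal_sup_ubound; exists d.
case: ereal_sup ub => [r|//|] ub.
  by rewrite lte_fin => ra; exists r => // d /ub.
move=> _; exists (alpha - 1); first by rewrite ltrBlDr ltrDl.
by move=> d /ub.
Qed.

Theorem corollary12 (R : realType) (E : completeNormedModType R)
    (hE : convex_block_compact ([set f : dual E | `|f| <= 1] : set (weak_star E)))
    (alpha : R) (D : set E) (hDconvex : convex_set D)
    (hDcompact : weakly_compact D)
    (P := [set f : dual E |
      `|f| = 1 /\ (ereal_sup [set (f d)%:E | d in D] < alpha%:E)%E])
    (hP0 : P !=set0) (hPNA : P `<=` @norm_attaining R E) :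
  reflexive_space E.
Proof.
apply: contrapT => nref.
have [F [t [t0 F1 Ft]]] := nonreflexive_dist nref.
have [f [x [f1 x1 fge fle]]] := james_sequence F1 t0 Ft.
have [h [h2 h0 hb]] := weak_star_null_sequence hE f1 fge fle.
have [C [CM Cb]] := null_sequence_sets h2 h0 hb x1.
have [f0 [f01 /ereal_sup_lt_bound[a aalpha f0a]]] := hP0.
pose B n := [set g | C n g /\ forall d, D d -> g d <= n.+1%:R^-1].
have BM : null_convex_sets B 2.
  split.
  - move=> n; have [|g Cg gD] := small_on_weakly_compact CM hDcompact (e := n.+1%:R^-1) _ n.
      by rewrite invr_gt0.
    by exists g.
  - move=> n g [Cg gD]; split; first exact: (ncs_decr CM).
    move=> d /gD gd; apply: le_trans gd _.
    by rewrite lef_pV2 ?posrE// ler_nat.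
  - move=> n g g' [Cg gD] [Cg' gD']; split; first exact: (ncs_mid CM).
    move=> d Dd; rewrite (_ : (2^-1 *: (g + g')) d = 2^-1 * (g d + g' d))//.
    have := gD _ Dd; have := gD' _ Dd; move: (n.+1%:R^-1) => r; lra.
  - by move=> g [Cg _]; exact: (ncs_bound CM).
  - by move=> y e /(ncs_null CM y)[N NP]; exists N => g [/NP].
have Bb g : B 0%N g -> t / 2 <= `|g| by move=> [/Cb].
(* The value of [g] on [D] will be at most [a + e]; [alpha'] lies strictly
   between [a + e] and [alpha], and [del] is small enough to have
   [a + e <= alpha' * `|g|] also when [alpha' < 0]. *)
pose alpha' := (a + alpha) / 2; pose e := (alpha - a) / 4.
have e0 : 0 < e by rewrite divr_gt0// subr_gt0.
pose del := e / (`|alpha'| + 1).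
have del0 : 0 < del by rewrite divr_gt0// ltr_wpDl.
have [s s0 sP] := nonattaining_perturbation BM (divr_gt0 t0 (ltr0n _ 2)) Bb f01 del0.
have [N _ /(_ N (leqnn _)) /= Ne] := near_infty_natSinv_lt
  (PosNum (divr_gt0 e0 (ltr_wpDl s0 ltr01))).
have [v [g [vB vg g1 gdel gNA]]] := sP N.
have g0 : 0 < `|g| by exact: lt_le_trans ltr01 g1.
have gD d : D d -> g d <= alpha' * `|g|.
  move=> Dd.
  have gae : g d <= a + e.
    have vgd : (fun n => v n d : R^o) @ \oo --> (g d : R^o).
      have := @dual_continuous R (dual E) (bidual_eval d) g; exact: cvg_comp.
    apply: (cvgr_to_le vgd); apply: nearW => n.
    have [w [_ wD] ->] := vB n.
    rewrite (_ : (f0 + s *: w) d = f0 d + s * w d)// lerD ?f0a//.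
    apply: (@le_trans _ _ (s * N.+1%:R^-1)); first by rewrite ler_wpM2l// wD.
    move: Ne; rewrite ltr_pdivlMr ?ltr_wpDl//.
    have : 0 < N.+1%:R^-1 :> R by rewrite invr_gt0.
    move: (N.+1%:R^-1) => r; lra.
  apply: le_trans gae _.
  have dele : `|alpha'| * del <= e.
    rewrite /del mulrCA ler_piMr ?(ltW e0)// ler_pdivrMr ?ltr_wpDl//.
    by rewrite mul1r lerDl.
  have gp : 0 <= `|g| - 1 by rewrite subr_ge0.
  have gm : `|g| - 1 <= del by rewrite lerBlDl.
  have h1 : `|alpha'| * (`|g| - 1) <= e by apply: le_trans dele; rewrite ler_wpM2l.
  have h3 : - `|alpha'| * (`|g| - 1) <= alpha' * (`|g| - 1).
    by rewrite ler_wpM2r// lerNl -normrN ler_norm.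
  have : a + 2 * e = alpha' by rewrite /e /alpha'; field.
  lra.
have /hPNA[y [y1 gy]] : P (`|g|^-1 *: g).
  split; first by rewrite normrZ ger0_norm ?invr_ge0// mulVf// gt_eqF.
  apply: (@le_lt_trans _ _ alpha'%:E); last by rewrite lte_fin /alpha'; lra.
  apply: ge_ereal_sup => _ [d Dd <-]; rewrite lee_fin.
  by rewrite (_ : (`|g|^-1 *: g) d = `|g|^-1 * g d)// ler_pdivrMl// mulrC gD.
apply: gNA; exists y; split=> //.
move: gy; rewrite (_ : (`|g|^-1 *: g) y = `|g|^-1 * g y)// normrZ.
by rewrite ger0_norm ?invr_ge0// => /mulfI; apply; rewrite invr_eq0 gt_eqF.
Qed.
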